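(* Let $S$ be a topological semigroup and let $T$ be a subsemigroup of $S$ having a tight ideal series $I_0\subseteq I_1\subseteq\cdots\subseteq I_m=T$. If, for some $k$ with $0\le k<m$, the set $D:=I_{k+1}\setminus I_k$ is a regular $\mathcal{D}$-class of $T$, then the closure $\operatorname{cl}_S(D)$ of $D$ in $S$ is not compact.
   Context: All topological spaces are assumed Hausdorff. A topological semigroup is a semigroup with a Hausdorff topology for which multiplication is (jointly) continuous. An ideal of a semigroup $T$ is a nonempty subset $I\subseteq T$ with $TI\cup IT\subseteq I$. A subset $D$ of a semigroup $T$ is $\omega$-unstable if $D$ is infinite and for any $a\in D$ and any infinite subset $B\subseteq D$ we have $aB\cup Ba\not\subseteq D$. An ideal series for a semigroup $T$ is a chain of ideals $I_0\subseteq I_1\subseteq\cdots\subseteq I_m=T$ of $T$; it is tight if $I_0$ is a finite set and $I_k\setminus I_{k-1}$ is an $\omega$-unstable subset of $T$ for each $k=1,\ldots,m$. Green's relations on a semigroup $T$: $s\,\mathcal{L}\,t$ iff $\{s\}\cup Ts=\{t\}\cup Tt$; $s\,\mathcal{R}\,t$ iff $\{s\}\cup sT=\{t\}\cup tT$; $\mathcal{D}$ is the join of the equivalence relations $\mathcal{L}$ and $\mathcal{R}$ (equivalently $\mathcal{L}\circ\mathcal{R}=\mathcal{R}\circ\mathcal{L}$). A $\mathcal{D}$-class is regular if it contains a regular element, i.e. an element $x$ with $xyx=x$ for some $y\in T$ (equivalently, all its elements are regular). *)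

(* Defs.v *)
From Stdlib Require Export Relation_Operators.
From HB Require Import structures.
From mathcomp Require Export all_boot.
From mathcomp Require Export boolp classical_sets functions cardinality topology.

Set Implicit Arguments.
Unset Strict Implicit.
Unset Printing Implicit Defensive.

Local Open Scope classical_set_scope.
Local Open Scope group_scope.

HB.mixin Record isTopologicalSemigroup S & Topological S & Semigroup S := {
  topsg_hausdorff : hausdorff_space S ;
  topsg_mul_continuous : continuous (fun x : S * S => x.1 * x.2) ;
}.

#[short(type="topologicalSemigroupType")]
HB.structure Definition TopologicalSemigroup :=
  {S of Topological S & Semigroup S & isTopologicalSemigroup S}.

(* Subsemigroups are subsets [T : set S]; all the notions below are relative
   to the semigroup [T], i.e. multipliers and witnesses range over [T] only. *)
Section SemigroupNotions.
Variable S : semigroupType.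
Implicit Types (T I D B : set S) (s t x y a : S).

(* Nonemptiness of [T] is not required here: it follows as soon as [T] has an
   ideal. *)
Definition subsemigroup T := forall x y, T x -> T y -> T (x * y).

Definition ideal T I :=
  [/\ I !=set0, I `<=` T &
      forall t x, T t -> I x -> I (t * x) /\ I (x * t)].

Definition omega_unstable T D :=
  [/\ D `<=` T, infinite_set D &
      forall a B, D a -> B `<=` D -> infinite_set B ->
        ~ ([set a * b | b in B] `|` [set b * a | b in B] `<=` D)].

(* A series I_0, ..., I_m is encoded as a sequence of sets whose values beyond
   the index m are irrelevant. *)
Definition ideal_series T (m : nat) (I : nat -> set S) :=
  [/\ forall k, k <= m -> ideal T (I k),
      forall k, k < m -> I k `<=` I k.+1 &
      I m = T].

Definition tight_ideal_series T (m : nat) (I : nat -> set S) :=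
  [/\ ideal_series T m I, finite_set (I 0) &
      forall k, k < m -> omega_unstable T (I k.+1 `\` I k)].

Definition greenL T s t :=
  [/\ T s, T t &
      [set s] `|` [set x * s | x in T] = [set t] `|` [set x * t | x in T]].

Definition greenR T s t :=
  [/\ T s, T t &
      [set s] `|` [set s * x | x in T] = [set t] `|` [set t * x | x in T]].

(* The join of L and R: the least equivalence relation on T containing both.
   The closure is taken over S, so the pairs (s, s) with s outside T are
   discarded. *)
Definition greenD T s t :=
  [/\ T s, T t &
      clos_refl_sym_trans S (fun x y => greenL T x y \/ greenR T x y) s t].

Definition Dclass T D := exists2 a, T a & D = [set t | greenD T a t].

Definition regular_elt T x := T x /\ exists2 y, T y & x * y * x = x.

Definition regular_Dclass T D := Dclass T D /\ exists2 x, D x & regular_elt T x.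

End SemigroupNotions.

(* Main.v *)
(* Let e be an idempotent of D. Every element of D is a product x * y with x
   L-related and y R-related to e, so one of these two classes, say that of the
   x's, is infinite. Each x has an inverse x' in D with x' * x = e. If the
   closure of D is compact, infinitely many pairs (x, x') accumulate at some
   (p, q) with q * p = e. As x * x0' always lies in D, instability forces
   x0' * x into I_k for all but finitely many x, so that e lies in the closure
   of I_k. But an idempotent limit of I_(j+1) outside I_(j+1) is, by
   instability again, a limit of I_j (products of nearby elements are near
   e * e = e and often fall into I_j); descending to the finite, hence closed,
   set I_0 shows that e lies in I_k, a contradiction. *)
Require Import Defs.

Set Implicit Arguments.
Unset Strict Implicit.
Unset Printing Implicit Defensive.

Local Open Scope classical_set_scope.

(** * Accumulation along infinite subsets of a compact set *)

(** The sets whose preimage contains all but finitely many points of [B] form a proper filter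
    containing [K]; any cluster point of it will do. *)
Lemma compact_infinite_cluster (U : Type) (X : topologicalType) (K : set X)
    (B : set U) (f : U -> X) :
  compact K -> infinite_set B -> (forall b, B b -> K (f b)) ->
  exists p : X, forall N, nbhs p N -> infinite_set (B `&` f @^-1` N).
Proof.
move=> cK infB BK.
pose F : set_system X := [set N | finite_set (B `&` ~` (f @^-1` N))].
have FF : ProperFilter F.
  split.
    by rewrite /F /= preimage_set0 setC0 setIT.
  split.
  - by rewrite /F /= preimage_setT setCT setI0; exact: finite_set0.
  - move=> P Q; rewrite /F /= => FP FQ.
    by rewrite preimage_setI setCI setIUr finite_setU.
  - move=> P Q PQ; rewrite /F /=; apply: sub_finite_set => b [Bb nQ].
    by split=> // Pb; apply: nQ; exact: PQ.
have [|p [_ Fp]] := cK F FF.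
  rewrite /F /=; suff -> : B `&` ~` (f @^-1` K) = set0 by exact: finite_set0.
  by rewrite -subset0 => b [Bb]; apply; exact: BK.
exists p => N pN finN.
have [||x [nNx Nx]] := Fp (~` N) N => //.
by rewrite /F /= preimage_setC setCK.
Qed.

(** The pairs [(g b, b)] accumulate at a point where [mu] equals [e]. Fixing one [g a] near its
    first coordinate and varying [b] near the second gives mixed products near [e], one of them in
    [J]. An abstract [mu] covers both the multiplication and its opposite. *)
Lemma compact_closure_limit (X : topologicalType) (mu : X * X -> X)
    (D J B : set X) (g : X -> X) (e : X) :
  hausdorff_space X -> continuous mu -> compact (closure D) ->
  infinite_set B -> B `<=` D -> (forall b, B b -> D (g b)) ->
  (forall b, B b -> mu (g b, b) = e) ->
  (forall a B', B a -> B' `<=` B -> infinite_set B' ->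
     exists2 b, B' b & J (mu (g a, b))) ->
  closure J e.
Proof.
move=> hX cmu cD infB BD gD ge muJ.
have [|[q p] pq] := compact_infinite_cluster
    (f := fun b : X => (g b, b)) (compact_setX cD cD) infB.
  by move=> b Bb; split; apply: subset_closure; [exact: gD|exact: BD].
have mue : mu (q, p) = e.
  apply: hX => N M nN nM; exists e; split; last exact: nbhs_singleton.
  have /pq/infinite_setN0[b [Bb]] := cmu _ _ nN.
  by rewrite /= ge.
move=> N; rewrite -mue => /cmu [[V W] /= [nV nW] VW].
have nVW : nbhs (q, p) (V `*` W) by exists (V, W).
have infVW := pq _ nVW.
have /infinite_setN0[a [Ba [Va _]]] := infVW.
have [b [Bb [_ Wb]] Jb] := muJ a _ Ba (@subIsetl _ _ _) infVW.
by exists (mu (g a, b)); split => //; apply: VW.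
Qed.

(** * Green's relations and factorization through an idempotent *)

Section Semigroup.
Variable S : semigroupType.
Implicit Types (T D B : set S) (a b d e x y : S).
Local Open Scope group_scope.

Lemma omega_unstable_escape T D a B :
  omega_unstable T D -> D a -> B `<=` D -> infinite_set B ->
  exists2 b, B b & ~ (D (a * b) /\ D (b * a)).
Proof.
move=> [_ _ uD] Da BD infB; apply: contrapT => noesc.
apply: (uD a B Da BD infB) => _ [] [b Bb <-].
all: by apply: contrapT => nD; apply: noesc; exists b => // -[].
Qed.

Lemma greenLP T s t : subsemigroup T -> greenL T s t <->
  [/\ T s, T t, s = t \/ (exists2 u, T u & u * t = s)
    & t = s \/ (exists2 u, T u & u * s = t)].
Proof.
move=> subT; split=> [[Ts Tt st]|[Ts Tt st ts]].
  have st' : ([set t] `|` [set x * t | x in T]) s by rewrite -st; left.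
  have ts' : ([set s] `|` [set x * s | x in T]) t by rewrite st; left.
  by split.
split=> //; apply/seteqP; split=> z [->|[u Tu <-]].
- by case: st => [->|[v Tv <-]]; [left|right; exists v].
- case: st => [->|[v Tv <-]]; right; first by exists u.
  by exists (u * v); [exact: subT|rewrite mulgA].
- by case: ts => [->|[v Tv <-]]; [left|right; exists v].
- case: ts => [->|[v Tv <-]]; right; first by exists u.
  by exists (u * v); [exact: subT|rewrite mulgA].
Qed.

Lemma greenRP T s t : subsemigroup T -> greenR T s t <->
  [/\ T s, T t, s = t \/ (exists2 u, T u & t * u = s)
    & t = s \/ (exists2 u, T u & s * u = t)].
Proof.
move=> subT; split=> [[Ts Tt st]|[Ts Tt st ts]].
  have st' : ([set t] `|` [set t * x | x in T]) s by rewrite -st; left.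
  have ts' : ([set s] `|` [set s * x | x in T]) t by rewrite st; left.
  by split.
split=> //; apply/seteqP; split=> z [->|[u Tu <-]].
- by case: st => [->|[v Tv <-]]; [left|right; exists v].
- case: st => [->|[v Tv <-]]; right; first by exists u.
  by exists (v * u); [exact: subT|rewrite mulgA].
- by case: ts => [->|[v Tv <-]]; [left|right; exists v].
- case: ts => [->|[v Tv <-]]; right; first by exists u.
  by exists (v * u); [exact: subT|rewrite mulgA].
Qed.

Lemma greenL_sym T s t : greenL T s t -> greenL T t s.
Proof. by case. Qed.

Lemma greenR_sym T s t : greenR T s t -> greenR T t s.
Proof. by case. Qed.

Lemma greenD_sym T s t : greenD T s t -> greenD T t s.
Proof. by case=> Ts Tt st; split=> //; exact: rst_sym. Qed.

Lemma greenD_trans T s t u : greenD T s t -> greenD T t u -> greenD T s u.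
Proof. by move=> [Ts _ st] [_ Tu tu]; split=> //; exact: rst_trans tu. Qed.

(* When e is idempotent, such an x is L-related to e, and x' is an inverse of
   x that is R-related to e. *)
Definition unit_pair T e x x' :=
  [/\ T x, T x', x' * x = e, x * e = x & e * x' = x'].

(** The second pair is written in the order [y' y]: for [e] idempotent, this puts [x] in the L-class
    and [y] in the R-class of [e]. *)
Definition green_factor T e d := exists x x' y y',
  [/\ unit_pair T e x x', unit_pair T e y' y & d = x * y].

Section GreenFactor.
Variables (T : set S) (e : S).
Hypotheses (subT : subsemigroup T) (Te : T e) (ee : e * e = e).

(** If [t = v * s] and [s = u * t], then [v * x] replaces [x], with partner [x' * u]: indeed
    [x' u v x = x' u v s y' = x' s y' = e]. *)
Lemma green_factorL s t : greenL T s t ->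
  green_factor T e s -> green_factor T e t.
Proof.
case/(greenLP _ _ subT)=> _ _ [-> //|[u Tu ut]] [-> //|[v Tv vs]].
move=> [x [x' [y [y' [[Tx Tx' x'x xe ex'] [Ty' Ty yy' y'e ey] sE]]]]].
exists (v * x), (x' * u), y, y'; split.
- split; [exact: subT|exact: subT| |by rewrite -mulgA xe|by rewrite mulgA ex'].
  have <- : x' * s * y' = e by rewrite sE mulgA x'x ey yy'.
  by rewrite -ut -vs sE !mulgA -(mulgA _ y y') yy' -(mulgA _ x e) xe.
- by split.
- by rewrite -mulgA -sE.
Qed.

Lemma green_factorR s t : greenR T s t ->
  green_factor T e s -> green_factor T e t.
Proof.
case/(greenRP _ _ subT)=> _ _ [-> //|[u Tu ut]] [-> //|[v Tv vs]].
move=> [x [x' [y [y' [[Tx Tx' x'x xe ex'] [Ty' Ty yy' y'e ey] sE]]]]].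
exists x, x', (y * v), (u * y'); split.
- by split.
- split; [exact: subT|exact: subT| |by rewrite -mulgA y'e|by rewrite mulgA ey].
  have <- : x' * s * y' = e by rewrite sE mulgA x'x ey yy'.
  by rewrite -ut -vs sE !mulgA x'x ey.
- by rewrite mulgA -sE.
Qed.

(** The element [y] links the two: it is R-related to [e] through [y'] and L-related to [x * y]
    through [x']. *)
Lemma greenD_mul x x' y y' :
  unit_pair T e x x' -> unit_pair T e y' y -> greenD T e (x * y).
Proof.
move=> [Tx Tx' x'x xe ex'] [Ty' Ty yy' y'e ey].
split=> //; first exact: subT.
apply: (rst_trans _ _ _ y); apply: rst_step.
- by right; apply/(greenRP _ _ subT); split=> //; right; [exists y'|exists y].
- left; apply/(greenLP _ _ subT); split=> //; first exact: subT.
    by right; exists x' => //; rewrite mulgA x'x.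
  by right; exists x.
Qed.

Lemma unit_pair_id : unit_pair T e e e.
Proof. by split. Qed.

(** Factorizations pass along L- and R-steps, and [e = e * e] is one to start from. *)
Lemma greenD_factor d : greenD T e d -> green_factor T e d.
Proof.
have step s t : clos_refl_sym_trans S (fun x y => greenL T x y \/ greenR T x y)
    s t -> green_factor T e s <-> green_factor T e t.
  elim=> {s t} [s t [st|st]|//|s t _ -> //|s t u _ -> _ -> //].
    by split; apply: green_factorL => //; exact: greenL_sym.
  by split; apply: green_factorR => //; exact: greenR_sym.
case=> _ _ /step [ed _]; apply: ed; exists e, e, e, e.
by split; rewrite ?ee //; exact: unit_pair_id.
Qed.

End GreenFactor.

(** If [r y r = r], then [y * r] is idempotent and L-related to [r]. *)
Lemma regular_Dclass_idempotent T D : subsemigroup T -> regular_Dclass T D ->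
  exists e, [/\ T e, e * e = e & D = [set t | greenD T e t]].
Proof.
move=> subT [[a Ta ->] [r ar [Tr [y Ty ryr]]]].
have er : greenD T (y * r) r.
  split=> //; first exact: subT.
  apply: rst_step; left; apply/(greenLP _ _ subT); split=> //; first exact: subT.
    by right; exists y.
  by right; exists r; rewrite // mulgA.
exists (y * r); split; first exact: subT.
  by rewrite mulgA -(mulgA y r y) -mulgA ryr.
apply/seteqP; split=> t /= at_; last first.
  exact: greenD_trans ar (greenD_trans (greenD_sym er) at_).
exact: greenD_trans er (greenD_trans (greenD_sym ar) at_).
Qed.

Lemma Dclass_infinite_LR T D e : subsemigroup T -> T e -> e * e = e ->
  D = [set t | greenD T e t] -> infinite_set D ->
  infinite_set [set x | exists x', unit_pair T e x x'] \/
  infinite_set [set y | exists y', unit_pair T e y' y].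
Proof.
move=> subT Te ee -> infD; apply/not_andP => -[finX finY]; apply: infD.
apply: sub_finite_set (finite_image (fun p => p.1 * p.2)
  (finite_setX finX finY)) => d /(greenD_factor subT Te ee).
move=> [x [x' [y [y' [xx' y'y ->]]]]].
by exists (x, y) => //; split; [exists x'|exists y'].
Qed.

End Semigroup.

(** * Idempotents in the closure of an ideal of the series *)

Section Closure.
Variables (S : topologicalSemigroupType) (T : set S).
Local Open Scope group_scope.

Lemma idempotent_closure_ideal m (I : nat -> set S) (e : S) j :
  tight_ideal_series T m I -> e * e = e -> j <= m ->
  closure (I j) e -> I j e.
Proof.
move=> [[idI subI _] fin0 unsI] ee.
have closed_fin : forall A : set S, finite_set A -> closed A.
  apply/accessible_finite_set_closed/hausdorff_accessible.
  exact: topsg_hausdorff.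
elim: j => [_|j IH jm clIe]; first exact: closed_fin.
apply: contrapT => nIe.
suff /(IH (ltnW jm)) : closure (I j) e by move/(subI _ jm).
move=> U nU.
have : nbhs (e, e) ((fun x : S * S => x.1 * x.2) @^-1` U).
  by apply: topsg_mul_continuous; rewrite /= ee.
move=> [[V1 V2] /= [nV1 nV2] VU].
(* Products of two points of [V], in either order, lie in [U], and so do the points themselves. *)
pose V := U `&` (V1 `&` V2).
have nV : nbhs e V by do 2?apply: filterI.
apply: contrapT => noI.
pose B := (I j.+1 `\` I j) `&` V.
(* Otherwise removing [B] from [V] leaves a neighbourhood of [e], since [e] is outside [I j.+1]; a
   point of [I j.+1] in it would lie in both [I j] and [U]. *)
have infB : infinite_set B.
  move=> /closed_fin/closed_openC oB.
  have [|b [Ib [Vb nBb]]] := clIe (V `&` ~` B).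
    by apply: filterI => //; apply: open_nbhs_nbhs; split=> // -[[]].
  apply: nBb; split=> //; split=> // Ijb; apply: noI.
  by exists b; split=> //; case: Vb.
have /infinite_setN0[a [Da [_ [V1a V2a]]]] := infB.
have [b [Db [_ [V1b V2b]]] nD] :=
  omega_unstable_escape (unsI _ jm) Da (@subIsetl _ _ _) infB.
have [_ IT idj] := idI _ jm.
have inU c d : V1 c -> V2 d -> U (c * d) by move=> Vc Vd; exact: (VU (c, d)).
have [Tb Ta] : T b /\ T a by split; apply: IT; [case: Db|case: Da].
have [Iba Iab] := idj _ _ Tb (proj1 Da).
apply: nD; split; split=> // ?; apply: noI.
- by exists (a * b); split=> //; exact: inU.
- by exists (b * a); split=> //; exact: inU.
Qed.

End Closure.

(** * Non-compactness of the closure *)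

Theorem theorem22 (S : topologicalSemigroupType) (T : set S) (m : nat)
    (I : nat -> set S) (k : nat) :
  subsemigroup T ->
  tight_ideal_series T m I ->
  k < m ->
  regular_Dclass T (I k.+1 `\` I k) ->
  ~ compact (closure (I k.+1 `\` I k)).
Proof.
move=> subT tI km /(regular_Dclass_idempotent subT)[e [Te ee DE]].
set D := _ `\` _ in DE * => cD.
have [[idI _ _] _ /(_ _ km) uD] := tI.
have De : D e by rewrite DE; split=> //; exact: rst_refl.
suff /(idempotent_closure_ideal tI ee (ltnW km)) : closure (I k) e.
  by case: De.
have DM x x' y y' : unit_pair T e x x' -> unit_pair T e y' y -> D (x * y)%g.
  by rewrite DE; exact: greenD_mul.
have De1 := unit_pair_id Te ee.
have DL x x' : unit_pair T e x x' -> D x.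
  by move=> xx'; have := DM _ _ _ _ xx' De1; case: xx' => _ _ _ ->.
have DR y y' : unit_pair T e y' y -> D y.
  by move=> y'y; have := DM _ _ _ _ De1 y'y; case: y'y => _ _ _ _ ->.
(* As [I k.+1] is an ideal, a product can leave [D] only by falling into [I k]. *)
have DI a b : D a -> D b -> ~ D (a * b)%g -> I k (a * b)%g.
  have [_ IT idk] := idI _ km.
  move=> [Ia _] [Ib _] nD; apply: contrapT => nI; apply: nD; split=> //.
  by have [] := idk a b (IT _ Ia) Ib.
case: (Dclass_infinite_LR subT Te ee DE) => [|infX|infY]; first by case: uD.
(* [g] picks a partner for each [x] having one; its default value elsewhere is arbitrary. *)
- have /choice[g gP] : forall x, exists x',
      (exists z, unit_pair T e x z) -> unit_pair T e x x'.
    move=> x; have [[z xz]|nx] := pselect (exists z, unit_pair T e x z).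
      by exists z.
    by exists x.
  apply: (compact_closure_limit (g := g) topsg_hausdorff topsg_mul_continuous
    cD infX).
  + by move=> x [x']; exact: DL.
  + by move=> x /gP; exact: DR.
  + by move=> x /gP[].
  + move=> a B /gP aP BX infB.
    have [|b Bb nD] := omega_unstable_escape uD (DR _ _ aP) _ infB.
      by move=> b /BX[b']; exact: DL.
    exists b => //=; have /gP bP := BX _ Bb.
    apply: DI; [exact: DR aP|exact: DL bP|].
    (* [b * g a] is an L-class element times an R-class element, hence in [D]; so the product
       escaping [D] must be [g a * b]. *)
    by move=> ab; apply: nD; split=> //; exact: DM bP aP.
- have /choice[g gP] : forall y, exists y',
      (exists z, unit_pair T e z y) -> unit_pair T e y' y.
    move=> y; have [[z yz]|ny] := pselect (exists z, unit_pair T e z y).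
      by exists z.
    by exists y.
  (* The dual case uses the opposite multiplication, because now [y * g y = e]. *)
  have cmu : continuous (fun p : S * S => p.2 * p.1)%g.
    move=> [x y] U nU.
    have [[V W] /= [nV nW] VW] := topsg_mul_continuous (y, x) _ nU.
    by exists (W, V) => // -[a b] [Wa Vb]; apply: (VW (b, a)).
  apply: (compact_closure_limit (g := g) topsg_hausdorff cmu cD infY).
  + by move=> y [y']; exact: DR.
  + by move=> y /gP; exact: DL.
  + by move=> y /gP[].
  + move=> a B /gP aP BY infB.
    have [|b Bb nD] := omega_unstable_escape uD (DL _ _ aP) _ infB.
      by move=> b /BY[b']; exact: DR.
    exists b => //=; have /gP bP := BY _ Bb.
    apply: DI; [exact: DR bP|exact: DL aP|].
    by move=> ba; apply: nD; split=> //; exact: DM aP bP.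
Qed.
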